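(* Let $k\ge2$, let $m$ be a positive integer, and let $\vec b=(b_0,b_1,\dots)$ and $\vec c=(c_0,c_1,\dots)$ be infinite sequences of integers. Suppose there exists a positive integer $u$ such that $b_jb_{j'}\equiv 0\pmod m$ for every pair of distinct integers $j,j'\in\{u,u+1,\dots,u+2k-1\}$. Then the sequence $\{\widehat{C}^{\vec b,\vec c}_{k,n}\bmod m\}_{n\ge0}$ is eventually periodic.
   Context: A $k$-dimensional balanced ballot path of length $kn$ is a sequence $P=(\vec s_1,\dots,\vec s_{kn})$ of standard unit vectors of $\mathbb{R}^k$ in which each $\vec e_i$ occurs exactly $n$ times and every intermediate point $\vec v_i=\sum_{j=1}^i\vec s_j$ ($0\le i\le kn$), $\vec x=(x_1,\dots,x_k)$, satisfies $x_1\ge\cdots\ge x_k$. The semisymmetric height of $\vec x\in\mathbb{Z}^k_{\ge0}$ is $g_k(\vec x)=\sum_{i=1}^k(k+1-2i)x_i$. A step $\vec e_i$ is a semisymmetric up-step if $i\le\lfloor k/2\rfloor$; all other steps (down-steps $\vec e_j$ with $j\ge k-\lfloor k/2\rfloor+1$, and for odd $k$ the neutral step $\vec e_{\lfloor k/2\rfloor+1}$) are non-up-steps. The semisymmetric weight of $P$ is $sswt_{\vec b,\vec c}(P)=\prod b_{u_i}\cdot\prod c_{u'_j}$, where the first product runs over the up-steps of $P$ with $u_i$ the semisymmetric height of the starting point of the $i$-th up-step, and the second runs over the non-up-steps with $u'_j$ the semisymmetric height of the resulting point of the $j$-th non-up-step. The $k$-dimensional semisymmetric weighted Catalan number is $\widehat{C}^{\vec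 b,\vec c}_{k,n}=\sum_P sswt_{\vec b,\vec c}(P)$, summed over all $k$-dimensional balanced ballot paths $P$ of length $kn$. *)

(* Defs.v *)
From mathcomp Require Import all_boot all_order all_algebra.

Set Implicit Arguments.
Unset Strict Implicit.
Unset Printing Implicit Defensive.

Import Order.TTheory GRing.Theory Num.Theory.
Local Open Scope ring_scope.

(* A path is given by the indices of its steps: the entry [s : 'I_k] stands for
   the standard unit vector [delta_mx 0 s].  Indices start at 0, so the step
   e_i of the mathematical text is the entry with value i - 1. *)

Definition vertex (k : nat) (P : seq 'I_k) (i : nat) : 'rV[nat]_k :=
  \sum_(s <- take i P) delta_mx 0 s.

Definition ballot_point (k : nat) (x : 'rV[nat]_k) : bool :=
  [forall i : 'I_k, forall j : 'I_k, (i <= j)%N ==> (x 0%R j <= x 0%R i)%N].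

Definition balanced_ballot_path (k n : nat) (P : (k * n).-tuple 'I_k) : bool :=
  [forall s : 'I_k, count_mem s P == n] &&
  [forall i : 'I_(k * n).+1, ballot_point (vertex P i)].

Definition ssheight (k : nat) (x : 'rV[nat]_k) : int :=
  \sum_(i < k) (k%:Z + 1 - 2 * (i.+1)%:Z) * (x 0 i)%:Z.

Definition ss_up_step (k : nat) (s : 'I_k) : bool := (s.+1 <= k./2)%N.

(* The absolute values only turn heights into natural-number indices.  By
   summation by parts, ssheight x is the sum over 1 <= i < k of
   i (k - i) (x_i - x_{i+1}), which is nonnegative at every ballot point. *)
Definition sswt (b c : nat -> int) (k n : nat) (P : (k * n).-tuple 'I_k) : int :=
  \prod_(i < k * n)
    if ss_up_step (tnth P i) then b `|ssheight (vertex P i)|%N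
    else c `|ssheight (vertex P i.+1)|%N.

Definition ssCatalan (b c : nat -> int) (k n : nat) : int :=
  \sum_(P : (k * n).-tuple 'I_k | balanced_ballot_path P) sswt b c P.

Definition eventually_periodic (T : Type) (a : nat -> T) : Prop :=
  exists N p : nat,
    (0 < p)%N /\ forall n : nat, (N <= n)%N -> a (n + p)%N = a n.

(* Main.v *)
(* Modulo m only the paths of height below u + 2k contribute: a path reaching
   that height has up-steps starting at two distinct heights of the window
   [u, u + 2k - 1].  At a ballot point the height dominates the differences of
   the coordinates, so up to translation along (1, ..., 1), which preserves
   heights, only finitely many points remain.  The numbers are thus, modulo m,
   weighted counts of closed walks of length kn in a finite graph, and the
   vector of such counts over all starting points takes finitely many values
   and determines its successor. *)
Require Import Defs.
From mathcomp Require Import all_boot all_order all_algebra.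
From mathcomp Require Import zify ring.

Import Order.TTheory GRing.Theory Num.Theory.
Local Open Scope ring_scope.

(** * Vertices of paths and step counts *)

Lemma vertex0 k (P : seq 'I_k) : vertex P 0 = 0.
Proof. by rewrite /vertex take0 big_nil. Qed.

Lemma vertexS k s (P : seq 'I_k) i :
  vertex (s :: P) i.+1 = delta_mx 0 s + vertex P i.
Proof. by rewrite /vertex /= big_cons. Qed.

Lemma vertex_tnth k L (P : L.-tuple 'I_k) (i : 'I_L) :
  vertex P i.+1 = vertex P i + delta_mx 0 (tnth P i).
Proof.
have iP : (i < size P)%N by rewrite size_tuple.
rewrite /vertex (take_nth (tnth P i) iP) -(tnth_nth (tnth P i)).
by rewrite -cats1 big_cat big_seq1.
Qed.

Lemma vertex_count k (P : seq 'I_k) i s :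
  vertex P i 0 s = count_mem s (take i P).
Proof.
rewrite /vertex; elim: (take i P) => [|t Q IH]; first by rewrite big_nil mxE.
by rewrite big_cons mxE IH mxE eqxx /= eq_sym; case: eqP.
Qed.

Lemma sum_count_mem (T : finType) (P : seq T) :
  (\sum_(s : T) count_mem s P)%N = size P.
Proof.
elim: P => [|t P IH] /=; first by rewrite big1.
rewrite big_split /= IH (bigD1 t) //= eqxx big1 // => s /negPf.
by rewrite eq_sym => ->.
Qed.

(** Balance is phrased without [n], so that it is invariant under translation along (1, ..., 1). *)
Definition level {k} (x : 'rV[nat]_k) : bool :=
  [forall i, forall j, x 0 i == x 0 j].

(** The counts add up to the length [k * n], so if they are all equal, each must be [n]. *)
Lemma level_vertex k n (P : (k * n).-tuple 'I_k) :
  level (vertex P (k * n)) = [forall s, count_mem s P == n].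
Proof.
have vE s : vertex P (k * n) 0 s = count_mem s P.
  by rewrite vertex_count take_oversize ?size_tuple.
apply/forallP/forallP => [lev s|all_n s]; last first.
  by apply/forallP => t; rewrite !vE (eqP (all_n s)) (eqP (all_n t)).
have k0 : (0 < k)%N by apply: leq_ltn_trans (ltn_ord s).
rewrite -(eqn_pmul2l k0) -[X in _ == X](size_tuple P) -(sum_count_mem _ P).
rewrite (eq_bigr (fun=> count_mem s P)) ?sum_nat_const ?card_ord // => t _.
by have /forallP/(_ s)/eqP := lev t; rewrite !vE.
Qed.

(** * Heights and ballot points *)

Lemma ssheight0 k : ssheight (0 : 'rV[nat]_k) = 0.
Proof. by apply: big1 => i _; rewrite mxE mulr0. Qed.

Lemma ssheightD k (x y : 'rV[nat]_k) :
  ssheight (x + y) = ssheight x + ssheight y.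
Proof.
rewrite /ssheight -big_split /=; apply: eq_bigr => i _.
by rewrite mxE -mulrDr -PoszD.
Qed.

Lemma ssheight_delta k (s : 'I_k) :
  ssheight (delta_mx 0 s) = k%:Z + 1 - 2 * (s.+1)%:Z.
Proof.
rewrite /ssheight (bigD1 s) //= big1 ?addr0 => [|i /negPf nis].
  by rewrite mxE !eqxx mulr1.
by rewrite mxE nis mulr0.
Qed.

(** Reversing the index negates the coefficient; add the original sum to the reversed one. *)
Lemma ssheight_sym k (x : 'rV[nat]_k) :
  ssheight x *+ 2 = \sum_(i < k) (k%:Z + 1 - 2 * (i.+1)%:Z) *
                      ((x 0 i)%:Z - (x 0 (rev_ord i))%:Z).
Proof.
rewrite mulr2n {2}/ssheight (reindex_inj rev_ord_inj) /ssheight -big_split /=.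
apply: eq_bigr => i _.
have -> : (k - i.+1).+1%:Z = k%:Z - i%:Z by have := ltn_ord i; lia.
ring.
Qed.

Lemma ssheight_const k (t : nat) : ssheight (const_mx t : 'rV[nat]_k) = 0.
Proof.
have: ssheight (const_mx t : 'rV[nat]_k) *+ 2 = 0.
  by rewrite ssheight_sym big1 // => i _; rewrite !mxE subrr mulr0.
lia.
Qed.

(** The two factors change sign together at the middle index. *)
Lemma ssheight_sym_ge0 k (x : 'rV[nat]_k) (i : 'I_k) : ballot_point x ->
  0 <= (k%:Z + 1 - 2 * (i.+1)%:Z) * ((x 0 i)%:Z - (x 0 (rev_ord i))%:Z).
Proof.
move=> bx; have ik := ltn_ord i.
have [iler|rlti] := leqP i (rev_ord i).
  have /forallP/(_ i)/forallP/(_ (rev_ord i)) := bx.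
  move/implyP/(_ iler) => xle; move: iler => /= iler.
  by apply: mulr_ge0; lia.
have /forallP/(_ (rev_ord i))/forallP/(_ i) := bx.
move/implyP/(_ (ltnW rlti)) => xle; move: rlti => /= rlti.
by apply: mulr_le0; lia.
Qed.

(** All terms of the symmetrised sum are nonnegative, and index [ord0] alone contributes [k.+1]
    times the largest coordinate difference. *)
Lemma ballot_spread k (x : 'rV[nat]_k.+2) (i : 'I_k.+2) : ballot_point x ->
  (x 0 i)%:Z - (x 0 ord_max)%:Z <= ssheight x *+ 2.
Proof.
move=> bx; rewrite ssheight_sym (bigD1 ord0) //=.
have rest : 0 <= \sum_(i < k.+2 | i != ord0) (k.+2%:Z + 1 - 2 * (i.+1)%:Z) *
                      ((x 0 i)%:Z - (x 0 (rev_ord i))%:Z).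
  by apply: sumr_ge0 => j _; apply: ssheight_sym_ge0.
have rev0 : rev_ord (ord0 : 'I_k.+2) = ord_max by apply/val_inj; rewrite /= subn1.
rewrite rev0.
have /forallP/(_ ord0)/forallP/(_ i)/implyP/(_ isT) xi0 := bx.
have /forallP/(_ i)/forallP/(_ ord_max)/implyP/(_ (leq_ord i)) xmi := bx.
move: rest; set S := \sum_(i | _) _; nia.
Qed.

Definition low_ballot {k} (H : nat) (x : 'rV[nat]_k) : bool :=
  ballot_point x && (ssheight x < H%:Z).

Lemma low_ballot_shift k H (x : 'rV[nat]_k) t :
  low_ballot H (x + const_mx t) = low_ballot H x.
Proof.
rewrite /low_ballot ssheightD ssheight_const addr0; congr andb.
by apply: eq_forallb => i; apply: eq_forallb => j; rewrite !mxE leq_add2r.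
Qed.

Lemma level_shift k (x : 'rV[nat]_k) t : level (x + const_mx t) = level x.
Proof.
by apply: eq_forallb => i; apply: eq_forallb => j; rewrite !mxE eqn_add2r.
Qed.

(* A bounded height bounds all coordinate differences, so up to translation
   along (1, ..., 1) there are finitely many low ballot points. *)
Lemma low_ballot_normal_form k H (x : 'rV[nat]_k.+2) : low_ballot H x ->
  exists (q : {ffun 'I_k.+2 -> 'I_(H.*2.+1)}) t,
    x = \row_i (q i : nat) + const_mx t.
Proof.
(* Differences to the last, smallest coordinate are at most twice the height, hence below [H.*2], so
   [inord] truncates nothing. *)
case/andP => bx hx; exists [ffun i => inord (x 0%R i - x 0%R ord_max)%N], (x 0 ord_max).
apply/rowP => i; rewrite !mxE ffunE inordK.
  have /forallP/(_ i)/forallP/(_ ord_max)/implyP/(_ (leq_ord i)) xmi := bx.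
  by rewrite -[RHS]/(_ + _)%N subnK.
by have := ballot_spread _ _ i bx; lia.
Qed.

Lemma crossing (h : nat -> int) (T : int) i : h 0%N < T -> T <= h i ->
  exists2 j, (j < i)%N & h j < T <= h j.+1.
Proof.
move=> h0; elim: i => [|i IH] hi; first by lia.
have [Ti|iT] := lerP T (h i); last by exists i => //; rewrite iT hi.
by have [j ji hj] := IH Ti; exists j => //; apply: ltnW.
Qed.

Lemma finite_sequence_repeats (T : finType) (a : nat -> T) :
  exists i j, (i < j)%N /\ a i = a j.
Proof.
have [/injectiveP inj|] := boolP (injectiveb (fun i : 'I_#|T|.+1 => a i)).
  by have := leq_card _ inj; rewrite card_ord ltnn.
case/injectivePn => i [j nij aij].
have [lt_ij|lt_ji|/val_inj eij] := ltngtP i j.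
- by exists i, j.
- by exists j, i.
- by rewrite eij eqxx in nij.
Qed.

(** * Truncated path sums and their recurrence *)

Section TransferOperator.

Variables (R : comNzRingType) (k H : nat) (b c : nat -> R).
Implicit Types (x : 'rV[nat]_k) (s : 'I_k).

Definition step_weight x s : R :=
  if ss_up_step s then b `|ssheight x|%N
  else c `|ssheight (x + delta_mx 0 s)%R|%N.

Fixpoint low_path_weight x (P : seq 'I_k) : R :=
  if P is s :: P' then
    if low_ballot H (x + delta_mx 0 s)
    then step_weight x s * low_path_weight (x + delta_mx 0 s) P' else 0
  else (level x)%:R.

Definition low_path_sum L x : R := \sum_(P : L.-tuple 'I_k) low_path_weight x P.

(** Unrolls the recursion into the product shape of [sswt], for the later comparison. *)
Lemma low_path_weightE L x (P : L.-tuple 'I_k) :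
  low_path_weight x P =
    if [forall i : 'I_L, low_ballot H (x + vertex P i.+1)]
         && level (x + vertex P L)
    then \prod_(i < L) step_weight (x + vertex P i) (tnth P i) else 0.
Proof.
elim: L x P => [|L IH] x P.
  rewrite tuple0 /= vertex0 addr0 big_ord0.
  have -> : [forall i : 'I_0, low_ballot H (x + vertex [tuple] i.+1)] = true.
    by apply/forallP => -[].
  by case: (level x).
case/tupleP: P => s P /=; rewrite IH vertexS addrA.
have -> : [forall i : 'I_L.+1, low_ballot H (x + vertex (s :: P) i.+1)] =
   low_ballot H (x + delta_mx 0 s) &&
   [forall i : 'I_L, low_ballot H (x + delta_mx 0 s + vertex P i.+1)].
  apply/forallP/andP => [all_low|[low0 /forallP lowS] i].
    split; first by have := all_low ord0; rewrite vertexS vertex0 addr0.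
    apply/forallP => i; have := all_low (lift ord0 i).
    by rewrite vertexS addrA.
  case: (unliftP ord0 i) => [j|] ->; last by rewrite vertexS vertex0 addr0.
  by rewrite vertexS addrA; apply: lowS.
case: (low_ballot H _) => //=.
case: ifP => _; last by rewrite mulr0.
rewrite big_ord_recl vertex0 addr0 tnth0; congr (_ * _).
by apply: eq_bigr => i _; rewrite vertexS addrA tnthS.
Qed.

(** Splitting off the first step: a fixed linear operator, independent of [L], sends the sums for
    [L] to those for [L.+1]. *)
Lemma low_path_sumS L x :
  low_path_sum L.+1 x =
    \sum_s if low_ballot H (x + delta_mx 0 s)
           then step_weight x s * low_path_sum L (x + delta_mx 0 s) else 0.
Proof.
rewrite /low_path_sum.
rewrite (reindex (fun p : 'I_k * L.-tuple 'I_k => cons_tuple p.1 p.2)) /=; last first.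
  exists (fun P => (thead P, [tuple of behead P])) => [[s P]|P] _ /=.
    by congr pair; apply: val_inj.
  by rewrite [RHS]tuple_eta.
rewrite -(pair_bigA _ (fun s (P : L.-tuple _) => low_path_weight x (s :: P))) /=.
apply: eq_bigr => s _; case: ifP => _; last by rewrite big1.
by rewrite mulr_sumr.
Qed.

Lemma low_path_sum_shift L x t : low_path_sum L (x + const_mx t) = low_path_sum L x.
Proof.
elim: L x => [|L IH] x.
  apply: eq_bigr => P _; rewrite tuple0 /=; congr (_%:R).
  by rewrite level_shift.
rewrite !low_path_sumS; apply: eq_bigr => s _.
rewrite addrAC low_ballot_shift IH; congr (if _ then _ * _ else _).
by rewrite /step_weight addrAC !ssheightD ssheight_const !addr0.
Qed.

End TransferOperator.

Arguments step_weight {R k}.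
Arguments low_path_sum {R k}.

Lemma low_path_sum_periodic (R : finComNzRingType) k H (b c : nat -> R) d :
  exists N p, (0 < p)%N /\ forall n, (N <= n)%N ->
    low_path_sum H b c (d * (n + p)) (0 : 'rV[nat]_k.+2) =
    low_path_sum H b c (d * n) (0 : 'rV[nat]_k.+2).
Proof.
pose F L x : R := low_path_sum H b c L (x : 'rV[nat]_k.+2).
pose a L := [ffun q : {ffun 'I_k.+2 -> 'I_(H.*2.+1)} => F L (\row_i (q i : nat))].
(* The finitely many normal forms recorded in [a L] determine the sum at every low ballot point. *)
have aS L L' : a L = a L' -> forall x, low_ballot H x -> F L x = F L' x.
  move=> eaL x /low_ballot_normal_form[q [t ->]].
  rewrite /F !low_path_sum_shift -!/(F _ _).
  by move/ffunP: eaL => /(_ q); rewrite !ffunE.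
(* The recurrence only evaluates the shorter sums at low points, so a coincidence propagates to all
   later lengths. *)
have aD L L' j : a L = a L' -> a (L + j)%N = a (L' + j)%N.
  move=> eaL; elim: j => [|j IH]; first by rewrite !addn0.
  rewrite !addnS; apply/ffunP => q; rewrite !ffunE /F !low_path_sumS.
  apply: eq_bigr => s _; case: ifP => // low.
  by rewrite -!/(F _ _) (aS _ _ IH).
(* The repetition is sought among multiples of [d], so that the period in length is a multiple of
   [d] too. *)
have [i [j [ij eij]]] := finite_sequence_repeats _ (fun n => a (d * n)%N).
exists i, (j - i)%N; split; first by rewrite subn_gt0.
move=> n le_in; pose q0 : {ffun 'I_k.+2 -> 'I_(H.*2.+1)} := [ffun=> ord0].
have z : 0 = \row_l (q0 l : nat) by apply/rowP => l; rewrite !mxE ffunE.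
have := aD _ _ (d * (n - i))%N eij; rewrite -!mulnDr subnKC //.
have -> : (j + (n - i) = n + (j - i))%N by lia.
by move/ffunP/(_ q0); rewrite !ffunE -z.
Qed.

(** * Reduction modulo [m] *)

(* Reaching height u + 2k means crossing u + k and then u + 2k; each crossing
   is an up-step of length at most k - 1, so the two starting heights lie in
   [u + 1, u + k - 1] and [u + k + 1, u + 2k - 1]. *)
Lemma high_path_weight0 (R : comNzRingType) (b c : nat -> R) k u L
    (P : L.-tuple 'I_k) (i0 : nat) :
  (0 < k)%N ->
  (forall j j', (u <= j <= u + 2 * k - 1)%N -> (u <= j' <= u + 2 * k - 1)%N ->
     j <> j' -> b j * b j' = 0) ->
  (i0 <= L)%N -> (u + 2 * k)%N%:Z <= ssheight (vertex P i0) ->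
  \prod_(i < L) step_weight b c (vertex P i) (tnth P i) = 0.
Proof.
move=> k0 bb i0L high; pose h i := ssheight (vertex P i).
have cross (T : int) : 0 < T -> T <= h i0 ->
    exists2 i : 'I_L, T - k%:Z < h i < T & ss_up_step (tnth P i).
  move=> T0 Ti; have [|j ji /andP[hj hSj]] := crossing h T i0 _ Ti.
    by rewrite /h vertex0 ssheight0.
  have jL : (j < L)%N by apply: leq_trans i0L.
  (* The increment [k + 1 - 2 * s.+1] of a crossing step [s] is positive, which forces
     [s.+1 <= k./2]. *)
  move: hSj; rewrite /h (vertex_tnth _ _ P (Ordinal jL)) ssheightD ssheight_delta /=.
  rewrite /h in hj; move=> hSj.
  exists (Ordinal jL); first by rewrite /h /= hj andbT; lia.
  by rewrite /ss_up_step; lia.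
have [||i1 /andP[lo1 hi1] up1] := cross (u + k)%N%:Z; rewrite /h; [lia|lia|].
have [||i2 /andP[lo2 hi2] up2] := cross (u + 2 * k)%N%:Z; rewrite /h; [lia|lia|].
have ni21 : i2 != i1 by apply/eqP => e; move: lo2; rewrite e; lia.
rewrite (bigD1 i1) //= (bigD1 i2) //= mulrA /step_weight up1 up2.
by rewrite bb ?mul0r //; rewrite /h in lo1 lo2 hi1 hi2; lia.
Qed.

(** Path by path: low balanced paths have the same weight on both sides, high ones have weight zero
    in [R], and all others are excluded on both sides. *)
Lemma ssCatalan_low_path_sum (R : comNzRingType) (b c : nat -> int) k u n :
  (0 < k)%N ->
  (forall j j', (u <= j <= u + 2 * k - 1)%N -> (u <= j' <= u + 2 * k - 1)%N ->
     j <> j' -> (b j)%:~R * (b j')%:~R = 0 :> R) ->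
  (ssCatalan b c k n)%:~R =
    low_path_sum (u + 2 * k) (fun j => (b j)%:~R) (fun j => (c j)%:~R)
      (k * n) (0 : 'rV[nat]_k) :> R.
Proof.
move=> k0 bb; rewrite rmorph_sum /= big_mkcond; apply: eq_bigr => P _.
rewrite low_path_weightE add0r level_vertex.
pose b' j : R := (b j)%:~R; pose c' j : R := (c j)%:~R.
have wtE : (sswt b c P)%:~R =
    \prod_(i < k * n) step_weight b' c' (0 + vertex P i) (tnth P i).
  rewrite rmorph_prod; apply: eq_bigr => i _.
  by rewrite add0r /step_weight -vertex_tnth; case: ifP.
rewrite wtE.
case: (boolP (balanced_ballot_path P)) => [/andP[-> /forallP bal]|].
  rewrite andbT; case: ifPn => // /forallPn[i].
  rewrite add0r negb_and (bal (lift ord0 i)) /= -leNgt => high.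
  under eq_bigr do rewrite add0r.
  exact: (high_path_weight0 _ _ _ _ _ _ _ _ k0 bb (ltn_ord i) high).
rewrite negb_and; case: [forall s, _] => /=; rewrite ?andbF //= andbT.
case/forallPn => i nbi; case: ifP => // /forallP low; case/negP: nbi.
(* [low] covers only the points after a step; the starting point is the origin, trivially a ballot
   point. *)
case: (unliftP ord0 i) => [j|] ->.
  by have /andP[] := low j; rewrite add0r.
by apply/forallP => s; apply/forallP => t; rewrite vertex0 !mxE implybT.
Qed.

Lemma intr_Zp_eq0 m (z : int) : (1 < m)%N ->
  (z%:~R == 0 :> 'Z_m) = (m%:Z %| z)%Z.
Proof.
move=> m1; have natE n : (n%:R == 0 :> 'Z_m) = (m %| n)%N.
  by rewrite -val_eqE /= val_Zp_nat // Zp_cast.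
by case: z => n; rewrite dvdzE /= ?NegzE ?mulrNz ?oppr_eq0 natE.
Qed.

Theorem theorem3p4 (k : nat) (hk : (2 <= k)%N) (m : nat) (hm : (0 < m)%N)
  (b c : nat -> int)
  (hu : exists u : nat, (0 < u)%N /\
    forall j j' : nat, (u <= j <= u + 2 * k - 1)%N ->
      (u <= j' <= u + 2 * k - 1)%N -> j <> j' ->
      (b j * b j' = 0 %[mod m%:Z])%Z) :
  eventually_periodic (fun n : nat => (ssCatalan b c k n %% m%:Z)%Z).
Proof.
(* The case [m = 1] is separate because ['Z_1] has two elements and is not the ring of integers
   modulo 1. *)
have [m1|m_le1] := ltnP 1 m; last first.
  have -> : m = 1%N by lia.
  by exists 0%N, 1%N; split=> // n _; rewrite !modz1.
have [u [_ bb]] := hu.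
have k0 : (0 < k)%N by lia.
have bbR j j' : (u <= j <= u + 2 * k - 1)%N -> (u <= j' <= u + 2 * k - 1)%N ->
    j <> j' -> (b j)%:~R * (b j')%:~R = 0 :> 'Z_m.
  move=> wj wj' njj'; apply/eqP; rewrite -intrM intr_Zp_eq0 //.
  by apply/dvdz_mod0P; rewrite bb // mod0z.
case: k hk k0 {hu bb} bbR => [|[|k]] // _ k0 bbR.
have [N [p [p0 per]]] := low_path_sum_periodic _ k (u + 2 * k.+2)
  (fun j => (b j)%:~R : 'Z_m) (fun j => (c j)%:~R) k.+2.
exists N, p; split=> // n Nn; apply/eqP; rewrite eqz_mod_dvd -intr_Zp_eq0 //.
by rewrite rmorphB /= !(ssCatalan_low_path_sum _ _ _ _ _ _ k0 bbR) per // subrr.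
Qed.
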